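(* Let $n \geq 2$ be an integer. No tournament on $3n-1$ vertices is intrinsically $n$-linked as a directed graph.
   Context: A tournament on $k$ vertices is a directed graph on $k$ vertices with exactly one directed edge between each pair of distinct vertices (equivalently, the complete graph $K_k$ with a choice of orientation of each edge). Embeddings are embeddings of the graph in $S^3$, in the usual (tame) sense of spatial graph theory. A cycle in a directed graph means a cycle of the underlying undirected graph; it is consistently oriented if its edges all point the same way around the cycle (i.e. it is a directed cycle). A directed graph $G$ is intrinsically $n$-linked as a directed graph (digraph) if every embedding of $G$ in $S^3$ contains $n$ pairwise disjoint, consistently oriented cycles that form a non-split $n$-component link. *)

(* Defs.v *)
From mathcomp Require Import all_boot all_order all_algebra.
From mathcomp Require Import all_classical all_reals all_analysis.
Import Order.TTheory GRing.Theory Num.Theory.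
Import numFieldNormedType.Exports.

Set Implicit Arguments.
Unset Strict Implicit.
Unset Printing Implicit Defensive.

Local Open Scope classical_set_scope.
Local Open Scope ring_scope.

(* A directed graph is a finite type of vertices with a relation [e];
   [e x y] means that there is an edge directed from x to y. *)

Definition tournament (V : finType) (e : rel V) : Prop :=
  (forall x, ~~ e x x) /\ (forall x y, x != y -> e x y (+) e y x).

(* A consistently oriented cycle, listed as its cyclic sequence of vertices.
   Loops and pairs of antiparallel edges, if present, are the cycles of length
   1 and 2 of the underlying undirected multigraph. *)
Definition consistent_cycle (V : finType) (e : rel V) (c : seq V) : Prop :=
  c <> [::] /\ ucycle e c.

Section SpatialGraphs.
Variable R : realType.

(* The unit sphere S^d in R^(d+1). *)
Definition sphere (d : nat) : set 'rV[R]_d.+1 :=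
  [set x | \sum_(i < d.+1) x 0 i ^+ 2 = 1].
Arguments sphere : clear implicits.

Definition homeomorphism_on (T U : topologicalType) (A : set T) (B : set U)
    (h : T -> U) : Prop :=
  {within A, continuous h} /\
  exists g : U -> T,
    [/\ {within B, continuous g},
        forall x, A x -> B (h x) /\ g (h x) = x &
        forall y, B y -> A (g y) /\ h (g y) = y].

(* The PL structure of S^3: a spherical simplex is the trace on S^3 of the
   convex cone spanned by linearly independent vectors (the rows of A), and a
   polyhedron is a finite union of spherical simplices. *)
Definition spherical_simplex (D : set 'rV[R]_4) : Prop :=
  exists (m : nat) (A : 'M[R]_(m, 4)),
    row_free A /\
    D = sphere 3 `&`
        [set x | exists2 a : 'rV[R]_m, (forall i, 0 <= a 0 i) & x = a *m A].

Definition polyhedron (P : set 'rV[R]_4) : Prop :=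
  exists F : set (set 'rV[R]_4),
    [/\ finite_set F, F `<=` spherical_simplex & P = \bigcup_(D in F) D].

Definition tame (X : set 'rV[R]_4) : Prop :=
  X `<=` sphere 3 /\
  exists h : 'rV[R]_4 -> 'rV[R]_4,
    homeomorphism_on (sphere 3) (sphere 3) h /\ polyhedron (h @` X).

(* [arc x y], restricted to [0, 1], parametrizes the edge from x to y; it is
   unconstrained when [e x y] fails. *)
Record embedding (V : finType) (e : rel V) := Embedding {
  pos : V -> 'rV[R]_4;
  arc : V -> V -> R -> 'rV[R]_4;
  pos_sphere : forall x, sphere 3 (pos x);
  pos_inj : injective pos;
  arc_sphere : forall x y t, e x y -> t \in `[0, 1] -> sphere 3 (arc x y t);
  arc_continuous : forall x y, e x y -> {within `[0, 1], continuous (arc x y)};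
  arc_ends : forall x y, e x y -> arc x y 0 = pos x /\ arc x y 1 = pos y;
  arc_avoids_pos : forall x y z t, e x y -> t \in `]0, 1[ -> arc x y t <> pos z;
  arc_inj : forall x y x' y' t t', e x y -> e x' y' ->
    t \in `]0, 1[ -> t' \in `]0, 1[ -> arc x y t = arc x' y' t' ->
    [/\ x = x', y = y' & t = t'];
  embedding_tame : tame (range pos `|`
    [set p | exists x y t, [/\ e x y, t \in `[0, 1] & p = arc x y t]])
}.

(* The simple closed curve traced by a directed cycle. *)
Definition cycle_curve (V : finType) (e : rel V) (f : embedding e)
    (c : seq V) : set 'rV[R]_4 :=
  [set p | exists x t, [/\ x \in c, t \in `[0, 1] & p = arc f x (next c x) t]].

Definition tame_two_sphere (S : set 'rV[R]_4) : Prop :=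
  tame S /\ exists h : 'rV[R]_3 -> 'rV[R]_4, homeomorphism_on (sphere 2) S h.

(* The complement of S has two connected components; each of them is required
   to contain a component of the link. *)
Definition split_link (n : nat) (K : 'I_n -> set 'rV[R]_4) : Prop :=
  exists S : set 'rV[R]_4,
    [/\ tame_two_sphere S,
        forall i, S `&` K i = set0 &
        forall z, (sphere 3 `\` S) z ->
          exists i, K i `<=` connected_component (sphere 3 `\` S) z].

Definition intrinsically_linked (n : nat) (V : finType) (e : rel V) : Prop :=
  forall f : embedding e,
    exists C : 'I_n -> seq V,
      [/\ forall i, consistent_cycle e (C i),
          forall i j x, i != j -> x \in C i -> x \notin C j &
          ~ split_link (fun i => cycle_curve f (C i))].

End SpatialGraphs.

(* Main.v *)
(** In a tournament every consistently oriented cycle has at least three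
    vertices, so [3 * n - 1] vertices never carry [n] disjoint ones.  It remains
    to see that the tournament has a tame embedding at all: place the vertices on
    the moment curve [(1, a, a^2, a^3)] of the affine hyperplane [x_0 = 1], join
    them by straight segments, and project the hyperplane radially to the sphere.
    A point common to two chords gives two convex combinations with the same value
    on every polynomial of degree at most 3; a cubic vanishing at three of the four
    endpoints shows that the fourth one is not distinct from them. *)

Require Import Defs.
From mathcomp Require Import all_boot all_order all_algebra.
From mathcomp Require Import all_classical all_reals all_analysis.
From mathcomp Require Import ring lra zify.
Import Order.TTheory GRing.Theory Num.Theory.
Import numFieldNormedType.Exports.

Set Implicit Arguments.
Unset Strict Implicit.
Unset Printing Implicit Defensive.

Local Open Scope classical_set_scope.
Local Open Scope ring_scope.

(** * Counting the vertices of disjoint cycles *)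

(** A cycle of length 1 would be a loop, one of length 2 a pair of antiparallel edges. *)
Lemma tournament_cycle_size (V : finType) (e : rel V) (c : seq V) :
  tournament e -> consistent_cycle e c -> (3 <= size c)%N.
Proof.
move=> [irr tot] []; case: c => [|x [|y [|z c]]] // _.
  by rewrite /ucycle /= !andbT (negbTE (irr x)).
rewrite /ucycle /= !andbT inE => /andP[/andP[exy eyx] xy].
by have := tot _ _ xy; rewrite exy eyx.
Qed.

(** Sending [(i, a)] to entry [a] of [C i] injects ['I_n * 'I_k] into [V]: disjointness recovers
    [i], and [uniq] then recovers [a]. *)
Lemma disjoint_long_seqs_card (V : finType) (n k : nat) (C : 'I_n -> seq V) :
  (forall i, uniq (C i)) -> (forall i, (k <= size (C i))%N) ->
  (forall i j x, i != j -> x \in C i -> x \notin C j) ->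
  (n * k <= #|V|)%N.
Proof.
(* [nth] needs a default [x0]; if [V] is empty, then [n] or [k] is zero. *)
move=> uC sC dC; case: (pickP (@predT V)) => [x0 _|V0]; last first.
  case: n C uC sC dC => [|n] C _ sC _; first by rewrite mul0n.
  have := sC ord0; case: (C ord0) => [|x s _]; last by have := V0 x.
  by rewrite leqn0 => /eqP ->; rewrite muln0.
pose f (p : 'I_n * 'I_k) := nth x0 (C p.1) p.2.
have fC p : f p \in C p.1 by rewrite mem_nth// (leq_trans (ltn_ord _)).
have f_inj : injective f.
  move=> [i a] [j b] fij.
  have ij : i = j.
    apply/eqP; apply: contraT => /dC /(_ (fC (i, a))).
    by rewrite fij (fC (j, b)).
  subst j; congr (_, _); apply/val_inj/eqP.
  have := fij; rewrite /f/= => /eqP.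
  by rewrite nth_uniq// (leq_trans (ltn_ord _)).
by have := leq_card f f_inj; rewrite card_prod !card_ord.
Qed.

(** * Radial projection and chords of the moment curve *)

Section MomentCurve.
Variable R : realType.
Implicit Types (u v : 'rV[R]_4) (a b c d s t : R).

Definition sqnorm u : R := \sum_(i < 4) u 0 i ^+ 2.

Definition radial u : 'rV[R]_4 := (Num.sqrt (sqnorm u))^-1 *: u.

Definition moment a : 'rV[R]_4 := \row_(i < 4) a ^+ i.

Definition chord a b t : 'rV[R]_4 := (1 - t) *: moment a + t *: moment b.

Lemma sqnormZ c u : sqnorm (c *: u) = c ^+ 2 * sqnorm u.
Proof. by rewrite mulr_sumr; apply: eq_bigr => i _; rewrite mxE exprMn. Qed.

Lemma sqnorm_gt0 u : u 0 0 = 1 -> 0 < sqnorm u.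
Proof.
move=> u1; rewrite /sqnorm big_ord_recl u1 expr1n ltr_wpDr//.
by apply: sumr_ge0 => i _; exact: sqr_ge0.
Qed.

Lemma radial_sphere u : u 0 0 = 1 -> @sphere R 3 (radial u).
Proof.
move=> /sqnorm_gt0 u0; rewrite /sphere/= -/(sqnorm _) sqnormZ exprVn.
by rewrite sqr_sqrtr ?ltW// mulVf// gt_eqF.
Qed.

(** Coordinate 0 of the projection is the inverse of the norm, so the norms agree and the scaling
    can be cancelled. *)
Lemma radial_inj u v : u 0 0 = 1 -> v 0 0 = 1 -> radial u = radial v -> u = v.
Proof.
move=> u1 v1 uv; have := congr1 (fun w : 'rV[R]_4 => w 0 0) uv.
rewrite !mxE u1 v1 !mulr1 => /invr_inj uvn.
move: uv; rewrite /radial uvn => /scalerI; apply.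
by rewrite invr_eq0 sqrtr_eq0 -ltNge sqnorm_gt0.
Qed.

(** The factor [c] must be the inverse of the norm of [u]. This identifies the points of a cone that
    lie on the sphere. *)
Lemma radialZ c u : @sphere R 3 (c *: u) -> 0 < c -> radial u = c *: u.
Proof.
rewrite /sphere/= -/(sqnorm _) sqnormZ => cu c0; congr (_ *: _).
have -> : sqnorm u = c^-1 ^+ 2.
  by rewrite exprVn -[LHS](mulKf (lt0r_neq0 (exprn_gt0 2 c0))) cu mulr1.
by rewrite sqrtr_sqr gtr0_norm ?invr_gt0// invrK.
Qed.

Lemma chord_coord0 a b t : chord a b t 0 0 = 1.
Proof. by rewrite !mxE !expr0 !mulr1 subrK. Qed.

Lemma chord0 a b : chord a b 0 = moment a.
Proof. by rewrite /chord subr0 scale1r scale0r addr0. Qed.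

Lemma chord1 a b : chord a b 1 = moment b.
Proof. by rewrite /chord subrr scale1r scale0r add0r. Qed.

Lemma moment_coord0 a : moment a 0 0 = 1.
Proof. by rewrite mxE expr0. Qed.

Lemma moment_inj : injective moment.
Proof.
move=> a b /(congr1 (fun w : 'rV[R]_4 => w 0 (inord 1))).
by rewrite !mxE inordK// !expr1.
Qed.

(** Coordinate [i] of a chord point is the convex combination of the values of ['X^i]; the identity
    follows by linearity in the coefficients of [p]. *)
Lemma chord_eq_horner a b c d s t (p : {poly R}) : (size p <= 4)%N ->
  chord a b s = chord c d t ->
  (1 - s) * p.[a] + s * p.[b] = (1 - t) * p.[c] + t * p.[d].
Proof.
move=> p4 E; rewrite !(horner_coef_wide _ p4) !mulr_sumr -!big_split/=.
apply: eq_bigr => i _; rewrite !(mulrCA _ p`_i) -!mulrDr; congr (_ * _).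
by have := congr1 (fun w : 'rV[R]_4 => w 0 i) E; rewrite !mxE.
Qed.

Lemma chord_eq_left a b c d s t : a != b -> s != 1 ->
  chord a b s = chord c d t -> a = c \/ a = d.
Proof.
move=> ab s1 E.
(* This cubic kills every term but [(1 - s) * p.[a]], so [a] is one of its roots as well. *)
pose p : {poly R} := \prod_(z <- [:: b; c; d]) ('X - z%:P).
have p4 : (size p <= 4)%N by rewrite size_prod_XsubC.
have pE x : p.[x] = (x - b) * ((x - c) * (x - d)).
  by rewrite /p !big_cons big_nil mulr1 !hornerE.
have := chord_eq_horner p4 E.
rewrite !pE !subrr !(mul0r, mulr0, addr0) => /eqP.
rewrite !mulf_eq0 !subr_eq0 eq_sym (negbTE s1) (negbTE ab)/=.
by move=> /orP[] /eqP; [left|right].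
Qed.

Lemma chord_sym a b t : chord a b t = chord b a (1 - t).
Proof. by rewrite /chord subKr addrC. Qed.

Lemma chord_eq_right a b c d s t : a != b -> s != 0 ->
  chord a b s = chord c d t -> b = c \/ b = d.
Proof.
rewrite (chord_sym a b) eq_sym => ab s0; apply: chord_eq_left => //.
by rewrite -subr_eq0 addrAC subrr sub0r oppr_eq0.
Qed.

(** A vertex is the degenerate chord from [c] to [c], which would force both [a] and [b] to equal
    [c]. *)
Lemma chord_neq_moment a b c t : a != b -> t \in `]0, 1[ ->
  chord a b t <> moment c.
Proof.
rewrite in_itv/= => ab /andP[t0 t1]; rewrite -(chord0 c c) => E.
have ac : a = c by case: (chord_eq_left ab (negbT (lt_eqF t1)) E).
have bc : b = c by case: (chord_eq_right ab (negbT (gt_eqF t0)) E).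
by move: ab; rewrite ac bc eqxx.
Qed.

Lemma chord_inj a b c d s t : a != b -> s \in `]0, 1[ ->
  chord a b s = chord c d t ->
  [/\ a = c, b = d & s = t] \/ (a = d /\ b = c).
Proof.
rewrite in_itv/= => ab /andP[s0 s1] E.
have aE := chord_eq_left ab (negbT (lt_eqF s1)) E.
have bE := chord_eq_right ab (negbT (gt_eqF s0)) E.
case: aE bE => a' [] b'; move: (ab); rewrite ?a' ?b' ?eqxx//; last by right.
move=> _; left; split=> //; subst.
(* The endpoints now agree, and the linear polynomial ['X] compares the parameters. *)
have := @chord_eq_horner _ _ _ _ _ _ 'X _ E.
rewrite size_polyX !hornerX => /(_ isT) E1.
have /eqP : (s - t) * (c - d) = 0 by lra.
by rewrite mulf_eq0 !subr_eq0 (negbTE ab) orbF => /eqP.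
Qed.

Lemma radial_chord_continuous a b : continuous (fun t => radial (chord a b t)).
Proof.
move=> t; rewrite /radial.
have Cc : {for t, continuous (chord a b)}.
  apply: cvgD; apply: cvgZr_tmp; last exact: cvg_id.
  by apply: cvgB; [exact: cvg_cst|exact: cvg_id].
apply: cvgZ => //.
(* The norm is nonzero because coordinate 0 of a chord point is 1. *)
apply: cvgV; first by rewrite sqrtr_eq0 -ltNge sqnorm_gt0// chord_coord0.
apply: (@continuous_comp _ _ _ (fun t => sqnorm (chord a b t)) Num.sqrt);
  last exact: sqrt_continuous.
apply: cvg_big => [|i _]; first exact: add_continuous.
apply: (@continuous_comp _ _ _ (fun t => chord a b t 0 i) (fun x => x ^+ 2));
  last exact: exprn_continuous.
apply: (@continuous_comp _ _ _ (chord a b) (fun w : 'rV[R]_4 => w 0 i)) => //.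
exact: coord_continuous.
Qed.

(** * Projected vertices and chords as spherical simplices *)

Lemma spherical_simplex_moment a :
  spherical_simplex [set radial (moment a)].
Proof.
exists 1, (moment a); split.
  rewrite /row_free rank_rV; suff -> : moment a != 0 by [].
  apply: contra_eq_neq (moment_coord0 a) => ->.
  by rewrite mxE eq_sym oner_eq0.
apply/seteqP; split => [_ ->|p [Sp [w w0 pE]]].
  split; first exact/radial_sphere/moment_coord0.
  exists (Num.sqrt (sqnorm (moment a)))^-1%:M; last by rewrite mul_scalar_mx.
  by move=> i; rewrite !ord1 mxE eqxx mulr1n invr_ge0 sqrtr_ge0.
have {}pE : p = w 0 0 *: moment a.
  by rewrite pE [in LHS](mx11_scalar w) mul_scalar_mx.
have := w0 0; rewrite le_eqVlt => /orP[/eqP c0|c0]; last first.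
  by rewrite pE in Sp *; rewrite /= (radialZ Sp).
move: Sp; rewrite pE -c0 /sphere/= -/(sqnorm _) sqnormZ expr0n mul0r.
by move/eqP; rewrite eq_sym oner_eq0.
Qed.

Lemma spherical_simplex_chord a b : a != b ->
  spherical_simplex [set radial (chord a b t) | t in `[0, 1]%classic].
Proof.
move=> ab.
pose A : 'M[R]_(2, 4) := \matrix_(i < 2) moment (if i == 0 then a else b).
have mulA w : w *m A = w 0 0 *: moment a + w 0 1 *: moment b.
  rewrite mulmx_sum_row !big_ord_recl big_ord0 addr0 !rowK/=.
  by congr (_ *: _ + w _ _ *: _); exact/val_inj.
exists 2, A; split.
  apply: inj_row_free => w; rewrite mulA => wA.
  have w0 := congr1 (fun p : 'rV[R]_4 => p 0 (inord 0)) wA.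
  have w1 := congr1 (fun p : 'rV[R]_4 => p 0 (inord 1)) wA.
  move: w0 w1; rewrite !mxE !inordK// !expr0 !expr1 !mulr1 => w0 w1.
  (* Coordinates 0 and 1 of the relation form a Vandermonde system in the two weights. *)
  have /eqP : w 0 0 * (a - b) = 0 by nra.
  rewrite mulf_eq0 subr_eq0 (negbTE ab) orbF => /eqP w00.
  apply/rowP => i; rewrite mxE.
  case: (eqVneq i 0) => [->//|i0].
  have -> : i = 1 by apply/val_inj; case: i i0 => [[|[|]]].
  by rewrite w00 add0r in w0.
apply/seteqP; split => [_ [t t01 <-]|p [Sp [w w0 pE]]].
  split; first exact/radial_sphere/chord_coord0.
  set N := (Num.sqrt (sqnorm (chord a b t)))^-1.
  have N0 : 0 <= N by rewrite invr_ge0 sqrtr_ge0.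
  exists (\row_i (N * (if i == 0 then 1 - t else t))).
    move: t01; rewrite /= in_itv/= => /andP[t0 t1] i.
    by rewrite mxE mulr_ge0//; case: ifP => _ //; rewrite subr_ge0.
  by rewrite mulA !mxE /radial -/N /chord scalerDr !scalerA.
rewrite mulA in pE; set s := w 0 0 in pE; set t := w 0 1 in pE.
have s0 : 0 <= s by exact: w0.
have t0 : 0 <= t by exact: w0.
(* Total weight zero would put the origin on the sphere. *)
have := addr_ge0 s0 t0; rewrite le_eqVlt => /orP[/eqP/esym/eqP|st0].
  rewrite paddr_eq0// => /andP[/eqP sE /eqP tE].
  move: Sp; rewrite pE sE tE !scale0r addr0 /sphere/= big1.
    by move/eqP; rewrite eq_sym oner_eq0.
  by move=> i _; rewrite mxE expr0n.
(* Dividing by the total weight moves the point back to the hyperplane where coordinate 0 is 1,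
   hence onto the chord. *)
have {}pE : p = (s + t) *: chord a b (t / (s + t)).
  rewrite pE /chord scalerDr !scalerA.
  by congr (_ *: _ + _ *: _); field; exact: lt0r_neq0.
exists (t / (s + t)).
  by rewrite /= in_itv/= divr_ge0 ?(ltW st0)//= ler_pdivrMr// mul1r lerDr.
by rewrite pE in Sp *; rewrite (radialZ Sp).
Qed.

End MomentCurve.

(** * Tameness of polyhedra *)

Lemma homeomorphism_on_id (T : topologicalType) (A : set T) :
  homeomorphism_on A A id.
Proof.
have idC : {within A, continuous (@id T)}.
  by apply: continuous_subspaceT => x; exact: cvg_id.
by split=> //; exists id.
Qed.

Lemma polyhedron_tame (R : realType) (X : set 'rV[R]_4) :
  X `<=` @sphere R 3 -> polyhedron X -> tame X.
Proof.
move=> XS pX; split=> //; exists id; split; first exact: homeomorphism_on_id.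
by rewrite image_id.
Qed.

Lemma tournament_neq (V : finType) (e : rel V) x y :
  tournament e -> e x y -> x != y.
Proof. by move=> [irr _] exy; apply: contraTneq exy => ->. Qed.

Lemma tournament_asym (V : finType) (e : rel V) x y :
  tournament e -> e x y -> ~~ e y x.
Proof.
move=> te exy; have := te.2 _ _ (tournament_neq te exy).
by rewrite exy.
Qed.

(** * The straight-line embedding of a tournament *)

Section MomentEmbedding.
Variables (R : realType) (V : finType) (e : rel V).
Hypothesis te : tournament e.

Definition param (x : V) : R := (enum_rank x)%:R.

Definition moment_pos (x : V) : 'rV[R]_4 := radial (moment (param x)).

Definition moment_arc (x y : V) (t : R) : 'rV[R]_4 :=
  radial (chord (param x) (param y) t).

Lemma param_inj : injective param.
Proof.
by move=> x y /eqP; rewrite eqr_nat => /eqP /val_inj /enum_rank_inj.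
Qed.

Lemma param_neq x y : e x y -> param x != param y.
Proof. by move=> /(tournament_neq te); rewrite (inj_eq param_inj). Qed.

Lemma moment_pos_sphere x : @sphere R 3 (moment_pos x).
Proof. exact/radial_sphere/moment_coord0. Qed.

Lemma moment_arc_sphere x y t : @sphere R 3 (moment_arc x y t).
Proof. exact/radial_sphere/chord_coord0. Qed.

Lemma moment_pos_inj : injective moment_pos.
Proof.
move=> x y /radial_inj; rewrite !moment_coord0 => /(_ erefl erefl).
by move=> /moment_inj /param_inj.
Qed.

Lemma moment_arc_ends x y :
  moment_arc x y 0 = moment_pos x /\ moment_arc x y 1 = moment_pos y.
Proof. by rewrite /moment_arc chord0 chord1. Qed.

Lemma moment_arc_avoids_pos x y z t : e x y -> t \in `]0, 1[ ->
  moment_arc x y t <> moment_pos z.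
Proof.
move=> exy t01 /radial_inj; rewrite moment_coord0 chord_coord0.
by move=> /(_ erefl erefl); apply: chord_neq_moment => //; exact: param_neq.
Qed.

(** The reversed alternative of [chord_inj] would give antiparallel edges, which a tournament
    excludes. *)
Lemma moment_arc_inj x y x' y' t t' : e x y -> e x' y' ->
  t \in `]0, 1[ -> moment_arc x y t = moment_arc x' y' t' ->
  [/\ x = x', y = y' & t = t'].
Proof.
move=> exy exy' t01 /radial_inj; rewrite !chord_coord0 => /(_ erefl erefl).
move=> /(chord_inj (param_neq exy) t01)[[/param_inj ? /param_inj ? ?]//|].
move=> [/param_inj ? /param_inj ?]; subst.
by have := tournament_asym te exy; rewrite exy'.
Qed.

Definition moment_graph : set 'rV[R]_4 :=
  range moment_pos `|`
  [set p | exists x y t, [/\ e x y, t \in `[0, 1] & p = moment_arc x y t]].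

Lemma moment_graph_polyhedron : polyhedron moment_graph.
Proof.
pose vertex x := [set moment_pos x].
pose edge (q : V * V) := [set moment_arc q.1 q.2 t | t in `[0, 1]%classic].
exists (range vertex `|` edge @` [set q | e q.1 q.2]); split.
- by rewrite finite_setU; split; exact/finite_image/finite_finset.
- move=> _ [[x _ <-]|[q eq <-]]; first exact: spherical_simplex_moment.
  exact/spherical_simplex_chord/param_neq.
- apply/seteqP; split => [p [[x _ <-]|[x [y [t [exy t01 ->]]]]]|p].
  + by exists (vertex x); [left; exists x|].
  + by exists (edge (x, y)); [right; exists (x, y)|exists t].
  + move=> [_ [[x _ <-] ->|[[x y] exy <-] [t t01 <-]]]; first by left; exists x.
    by right; exists x, y, t.
Qed.

Lemma moment_graph_tame : tame moment_graph.
Proof.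
apply: polyhedron_tame moment_graph_polyhedron => p.
case=> [[x _ <-]|[x [y [t [_ _ ->]]]]]; first exact: moment_pos_sphere.
exact: moment_arc_sphere.
Qed.

Definition moment_embedding : embedding R e :=
  Embedding moment_pos_sphere moment_pos_inj
    (fun x y t _ _ => moment_arc_sphere x y t)
    (fun x y _ => continuous_subspaceT (@radial_chord_continuous R _ _))
    (fun x y _ => moment_arc_ends x y)
    moment_arc_avoids_pos
    (fun x y x' y' t t' exy exy' t01 _ => moment_arc_inj exy exy' t01)
    moment_graph_tame.

End MomentEmbedding.

Theorem proposition7p1 (R : realType) (n : nat) (hn : (2 <= n)%N)
    (V : finType) (e : rel V) (hV : #|V| = (3 * n - 1)%N)
    (he : tournament e) :
  ~ intrinsically_linked R n e.
Proof.
move=> /(_ (moment_embedding R he))[C [cC dC _]].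
have := @disjoint_long_seqs_card V n 3 C _ _ dC.
(* [n * 3 <= 3 * n - 1] is absurd for positive [n]; at [n = 0] truncated subtraction would make it
   true. *)
rewrite hV => /(_ _ _)/wrap[i|i|]; last lia.
  by have [_ /andP[]] := cC i.
exact: tournament_cycle_size (cC i).
Qed.
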